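(* For every integer $n \ge 3$: $\phi_{6n}(1) = v(n)$ if $v(n) \equiv 1 \pmod 3$, and $\phi_{6n}(1) = -v(n)$ if $v(n) \equiv -1 \pmod 3$ or $v(n) = 2$ or $v(n) = 3$.
   Context: For an integer $m \ge 3$, let $\phi_m(x) \in \mathbb{Z}[x]$ denote the minimal polynomial of $4\sin^2\left(\frac{\pi}{m}\right)$, normalized (up to sign) so that its constant term is positive; equivalently, $\phi_m(x) = \prod_{0 < j < \frac{m}{2},\ \gcd(j,m)=1} \left(4\sin^2\left(\frac{j\pi}{m}\right) - x\right)$. For an integer $n > 1$, define $v(n) = p$ if $n = p^k$ is a power ($k \ge 1$) of a prime $p$, and $v(n) = 1$ otherwise. *)

(* Defs.v *)
From HB Require Import structures.
From mathcomp Require Import all_boot all_order all_algebra.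
From mathcomp Require Import all_classical all_reals all_analysis.

Set Implicit Arguments.
Unset Strict Implicit.
Unset Printing Implicit Defensive.

Import Order.TTheory GRing.Theory Num.Theory.

Local Open Scope classical_set_scope.
Local Open Scope ring_scope.

Definition is_min_poly (R : realType) (x : R) (q : {poly rat}) : Prop :=
  [/\ q \is monic,
      root (map_poly ratr q) x
    & forall r : {poly rat}, r != 0 -> root (map_poly ratr r) x ->
        (size q <= size r)%N].

(* The minimal polynomial of [4 * sin (pi / m) ^+ 2] over the rationals,
   negated if necessary so that its constant coefficient is positive, as a
   polynomial with integer coefficients; meaningful for [3 <= m].  The default
   value 0 is taken only if no such integer polynomial exists. *)
Definition phi (R : realType) (m : nat) : {poly int} :=
  xget 0 [set p : {poly int} |
    (is_min_poly (4 * sin (pi / m%:R : R) ^+ 2) (map_poly intr p) \/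
     is_min_poly (4 * sin (pi / m%:R : R) ^+ 2) (- map_poly intr p))
    /\ 0 < p`_0].

(* Meaningful for [1 < n].  The prime [p] is unique when it exists, and the
   default value 1 is taken exactly when [n] is not a prime power. *)
Definition v (n : nat) : nat :=
  xget 1%N [set p : nat | prime p /\ exists2 k : nat, (1 <= k)%N & n = (p ^ k)%N].

(* Main.v *)
(** Write [N = 6n] and [d = totient N / 2].  As ['Phi_N] is palindromic, there
    is an integer polynomial [q] with ['Phi_N(x) = x ^ d * q(2 - x - 1/x)].  For
    [z = exp(2 i pi / N)] one has [2 - z - 1/z = 4 sin(pi/N) ^ 2], so
    irreducibility of ['Phi_N] makes [q] the minimal polynomial of that number up
    to sign; moreover [q(0) = 'Phi_N(1)], and [q(1) = 'Phi_N(w) / w ^ d] for a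
    primitive 6th root of unity [w].

    The quotient [g_m(x) = 'Phi_m(x) / x ^ (totient m / 2)] is invariant under
    [x -> 1/x] and, for [p] prime, [g_(pm)(x)] is [g_m(x ^ p)] if [p] divides [m]
    and [g_m(x ^ p) / g_m(x)] otherwise.  If [x ^ 6 = 1] and [p] is prime to 6,
    then [x ^ p] is [x] or [1/x], so removing from [N] a prime [p > 3] divides two
    equal values: the result is 1 unless both vanish, that is unless
    [n = p ^ k] and [x = w], in which case a derivative gives [p] or [-p]
    according to [p] mod 3.  If only 2 and 3 divide [n], then
    [g_N(w) = g_6(w ^ n)]. *)

Require Import Defs.
From mathcomp Require Import all_boot all_order all_algebra all_field.
From mathcomp Require Import complex ring lra zify.
From mathcomp Require Import all_classical all_reals all_analysis.

Import Order.TTheory GRing.Theory Num.Theory.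
Local Open Scope ring_scope.
Set Implicit Arguments.
Unset Strict Implicit.
Unset Printing Implicit Defensive.

Local Notation pZtoQ := (map_poly (intr : int -> rat)).
Local Notation pZtoC := (map_poly (intr : int -> algC)).

(** * Cyclotomic polynomials *)

Lemma map_ratr_intr (F : numFieldType) (p : {poly int}) :
  map_poly (ratr : rat -> F) (pZtoQ p) = map_poly intr p.
Proof. by rewrite -map_poly_comp; apply: eq_map_poly => a; rewrite /= ratr_int. Qed.

Lemma size_pZtoQ (p : {poly int}) : size (pZtoQ p) = size p.
Proof. by rewrite size_map_inj_poly //; apply: intr_inj. Qed.

Lemma root_Cyclotomic_algC n (z : algC) : (0 < n)%N ->
  root (map_poly intr 'Phi_n) z = n.-primitive_root z.
Proof.
move=> n_gt0; have [w w_prim] := C_prim_root_exists n_gt0.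
by rewrite (Cintr_Cyclotomic w_prim) root_cyclotomic.
Qed.

Lemma Cyclotomic_dvd_Xn_sub_1 n : (0 < n)%N ->
  exists q : {poly int}, 'X^n - 1 = q * 'Phi_n.
Proof.
move=> n_gt0; rewrite -(prod_Cyclotomic n_gt0) (big_rem n) /=.
  by eexists; rewrite mulrC.
by rewrite -dvdn_divisors.
Qed.

(** By the factorisation of ['X^n - 1], [z] is a root of some ['Phi_d] with [d] dividing [n]; then
    [z ^+ d = 1], so [n] divides [d]. *)
Lemma root_Cyclotomic (F : idomainType) n (z : F) :
  n.-primitive_root z -> root (map_poly intr 'Phi_n) z.
Proof.
move=> z_prim; have n_gt0 := prim_order_gt0 z_prim.
have /(congr1 (fun p => (map_poly (intr : int -> F) p).[z])) :=
  prod_Cyclotomic n_gt0.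
rewrite rmorph_prod rmorphB rmorph1 /= map_polyXn horner_prod !hornerE.
rewrite (prim_expr_order z_prim) subrr => /eqP.
rewrite prodf_seq_eq0 => /hasP[d]; rewrite -dvdn_divisors //= => d_n zd0.
suff -> : n = d by [].
apply/eqP; rewrite eqn_dvd d_n andbT (prim_order_dvd z_prim).
have d_gt0 := dvdn_gt0 n_gt0 d_n.
have [q /(congr1 (fun p => (map_poly (intr : int -> F) p).[z]))] :=
  Cyclotomic_dvd_Xn_sub_1 d_gt0.
rewrite rmorphB rmorphM rmorph1 /= map_polyXn !hornerE (eqP zd0) mulr0.
by move/subr0_eq/eqP.
Qed.

(** A common root in [F] makes the gcd nonconstant, so it also has a root in [algC], whose minimal
    polynomial is ['Phi_n]. *)
Lemma Cyclotomic_dvd (F : numFieldType) n (z : F) (p : {poly rat}) :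
  (0 < n)%N -> root (map_poly intr 'Phi_n) z -> root (map_poly ratr p) z ->
  pZtoQ 'Phi_n %| p.
Proof.
move=> n_gt0 Phiz pz; set g := gcdp (pZtoQ 'Phi_n) p.
have gz : root (map_poly ratr g) z.
  by rewrite gcdp_map root_gcd map_ratr_intr Phiz.
have g_neq0 : g != 0.
  by rewrite gcdp_eq0 negb_and -size_poly_eq0 size_pZtoQ size_Cyclotomic.
have [u gu] : exists u : algC, root (map_poly ratr g) u.
  apply/closed_rootP; rewrite size_map_poly.
  have := root_size_gt1 (_ : map_poly (ratr : {rmorphism rat -> F}) g != 0) gz.
  by rewrite map_poly_eq0 size_map_poly => /(_ g_neq0); case: (size g) => [|[|]].
move: gu; rewrite gcdp_map root_gcd map_ratr_intr root_Cyclotomic_algC //.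
case/andP=> u_prim pu; have [pf [Dpf _] dv_pf] := minCpolyP u.
suff <- : pf = pZtoQ 'Phi_n by rewrite -dv_pf.
apply: (map_poly_inj (ratr : {rmorphism rat -> algC})).
by rewrite -Dpf (minCpoly_cyclotomic u_prim) map_ratr_intr (Cintr_Cyclotomic u_prim).
Qed.

Lemma monic_pZtoQ (p : {poly int}) : (pZtoQ p \is monic) = (p \is monic).
Proof.
rewrite !monicE (lead_coef_map_inj (@intr_inj rat)) //.
exact: (inj_eq (@intr_inj rat) _ 1).
Qed.

(** Reduces the polynomial identities below to divisibility over the rationals and a degree
    count. *)
Lemma monic_dvd_size_eq (p q : {poly int}) : p \is monic -> q \is monic ->
  (size q <= size p)%N -> pZtoQ p %| pZtoQ q -> p = q.
Proof.
move=> p_monic q_monic size_qp pq.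
apply: (map_inj_poly (intr_inj : injective (intr : int -> rat))) => //.
apply/eqP; rewrite -eqp_monic ?monic_pZtoQ //.
rewrite -(dvdp_size_eqp pq) !size_pZtoQ eqn_leq size_qp andbT.
by rewrite -!size_pZtoQ dvdp_leq // monic_neq0 // monic_pZtoQ.
Qed.

Lemma Cyclotomic6 : 'Phi_6 = 'X^2 - 'X + 1.
Proof.
have [z z_prim] := C_prim_root_exists (isT : (0 < 6)%N).
have z3 : z ^+ 3 = -1.
  have : (z ^+ 3) ^+ 2 == 1 by rewrite -exprM (prim_expr_order z_prim).
  rewrite sqrf_eq1 -(prim_order_dvd z_prim) /= => /eqP //.
have z1 : z + 1 != 0.
  apply: contraL isT => /eqP/addr0_eq z1.
  by have := prim_order_dvd z_prim 2; rewrite -sqrrN z1 expr1n eqxx.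
have size6 : size ('X^2 - 'X + 1 : {poly int}) = 3%N.
  rewrite -addrA size_polyDl size_polyXn //.
  by rewrite size_polyDl ?size_polyN ?size_polyX // size_poly1.
apply: monic_dvd_size_eq; rewrite ?Cyclotomic_monic //.
- by rewrite monicE lead_coefE size6 /= !coefE.
- by rewrite size6 size_Cyclotomic.
apply: (@Cyclotomic_dvd algC _ z) => //; first exact: root_Cyclotomic.
rewrite map_ratr_intr rmorphD rmorphB /= map_polyXn map_polyX rmorph1.
(* [(z + 1) * (z ^+ 2 - z + 1)] is [z ^+ 3 + 1]. *)
apply/eqP; rewrite !hornerE; apply: (mulfI z1).
by rewrite mulr0 -[0](subrr (-1 : algC)) -{1}z3; ring.
Qed.

(** * Replacing x by x ^ p in a cyclotomic polynomial *)

Lemma comp_Xn_monic (p : {poly int}) k : (0 < k)%N -> p \is monic ->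
  p \Po 'X^k \is monic.
Proof.
move=> k_gt0 /monicP p_monic.
by rewrite monicE lead_coef_comp ?size_polyXn // p_monic lead_coefXn expr1n mulr1.
Qed.

Lemma size_comp_Xn (R : idomainType) (p : {poly R}) n k : (0 < k)%N ->
  size p = n.+1 -> size (p \Po 'X^k) = (k * n).+1.
Proof.
move=> k_gt0 sp; rewrite polySpred; last first.
  by rewrite comp_poly_eq0 ?size_polyXn // -size_poly_eq0 sp.
by rewrite size_comp_poly sp size_polyXn /= mulnC.
Qed.

Lemma root_comp_Xn (F : fieldType) (p : {poly int}) k (z : F) :
  root (map_poly intr (p \Po 'X^k)) z = root (map_poly intr p) (z ^+ k).
Proof. by rewrite map_comp_poly map_polyXn /root horner_comp hornerXn. Qed.

Lemma totient_pmul p m : prime p -> (0 < m)%N ->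
  totient (p * m) = (if p %| m then p * totient m else p.-1 * totient m)%N.
Proof.
move=> p_pr m_gt0; case: ifP => p_m; last first.
  have cpm : coprime p m by rewrite prime_coprime // p_m.
  by rewrite totient_coprime // totient_prime.
have lp : (0 < logn p m)%N by rewrite logn_gt0 mem_primes p_pr m_gt0.
have [n cpn ->] := pfactor_coprime p_pr m_gt0.
rewrite [(n * _)%N]mulnC -(prednK lp).
have totpow e : totient (p ^ e * n) = (totient (p ^ e) * totient n)%N.
  by rewrite totient_coprime ?coprimeXl.
move: (logn p m).-1 => e.
by rewrite mulnA -expnS !totpow !totient_pfactor //= expnS; lia.
Qed.

(** The [p]-th power of a primitive root of order [p * m] has order [m], which gives divisibility;
    the degrees agree since [totient (p * m)] is [p * totient m]. *)
Lemma Cyclotomic_comp_dvd p m : prime p -> (0 < m)%N -> (p %| m)%N ->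
  'Phi_m \Po 'X^p = 'Phi_(p * m).
Proof.
move=> p_pr m_gt0 p_m; have p_gt0 := prime_gt0 p_pr.
have pm_gt0 : (0 < p * m)%N by rewrite muln_gt0 p_gt0.
have [z z_prim] := C_prim_root_exists pm_gt0.
apply/esym/monic_dvd_size_eq; rewrite ?comp_Xn_monic ?Cyclotomic_monic //.
  by rewrite (size_comp_Xn p_gt0 (size_Cyclotomic m)) size_Cyclotomic totient_pmul // p_m.
apply: (@Cyclotomic_dvd algC _ z) => //; first exact: root_Cyclotomic.
rewrite map_ratr_intr root_comp_Xn root_Cyclotomic //.
have := dvdn_prim_root z_prim (dvdn_mull p (dvdnn m)).
by rewrite mulnK.
Qed.

(** Both factors on the right divide the left side, the second because the [p]-th power of a
    primitive [m]-th root is again one. They have no common root, and the degrees add up to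
    [p * totient m]. *)
Lemma Cyclotomic_comp_ndvd p m : prime p -> (0 < m)%N -> ~~ (p %| m)%N ->
  'Phi_m \Po 'X^p = 'Phi_(p * m) * 'Phi_m.
Proof.
move=> p_pr m_gt0 p_m; have p_gt0 := prime_gt0 p_pr.
have pm_gt0 : (0 < p * m)%N by rewrite muln_gt0 p_gt0.
have [z z_prim] := C_prim_root_exists pm_gt0.
have [u u_prim] := C_prim_root_exists m_gt0.
apply/esym/monic_dvd_size_eq;
  rewrite ?monicMl ?comp_Xn_monic ?Cyclotomic_monic //.
  rewrite (size_comp_Xn p_gt0 (size_Cyclotomic m)) size_Mmonic ?Cyclotomic_monic //.
    rewrite !size_Cyclotomic totient_pmul // (negPf p_m) /=; nia.
  by rewrite monic_neq0 ?Cyclotomic_monic.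
rewrite rmorphM /= Gauss_dvdp.
  apply/andP; split.
    apply: (@Cyclotomic_dvd algC _ z) => //; first exact: root_Cyclotomic.
    rewrite map_ratr_intr root_comp_Xn root_Cyclotomic //.
    have := dvdn_prim_root z_prim (dvdn_mull p (dvdnn m)).
    by rewrite mulnK.
  apply: (@Cyclotomic_dvd algC _ u) => //; first exact: root_Cyclotomic.
  rewrite map_ratr_intr root_comp_Xn root_Cyclotomic //.
  by rewrite prim_root_exp_coprime // prime_coprime.
rewrite -(coprimep_map (ratr : {rmorphism rat -> algC})) !map_ratr_intr.
apply: contraNT p_m => /closed_rootP[x].
rewrite root_gcd !root_Cyclotomic_algC // => /andP[pmx mx].
have : (p * m %| m)%N by rewrite (prim_order_dvd pmx) (prim_expr_order mx).
by move/(dvdn_leq m_gt0); have := prime_gt1 p_pr; nia.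
Qed.

(** * Palindromic polynomials *)

Lemma horner_rev_poly (F : fieldType) (p : {poly F}) d x : x != 0 ->
  (size p <= d.+1)%N ->
  (\poly_(i < d.+1) p`_(d - i)).[x] = x ^+ d * p.[x^-1].
Proof.
move=> x0 size_p; rewrite horner_poly (horner_coef_wide _ size_p) mulr_sumr.
rewrite (reindex_inj rev_ord_inj) /=; apply: eq_bigr => i _.
have le_id : (i <= d)%N by rewrite -ltnS.
rewrite subSS subKn // expfB_cond ?(negPf x0) ?add0n // exprVn; ring.
Qed.

(** With [z] also [1/z] is primitive, so the reversed polynomial vanishes at [z] and is a constant
    multiple of ['Phi_n]. Both agree at 1, where they are nonzero as [n > 1]. *)
Lemma Cyclotomic_palindrome n i : (1 < n)%N -> (i <= totient n)%N ->
  'Phi_n`_i = 'Phi_n`_(totient n - i).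
Proof.
move=> n_gt1 le_i; have n_gt0 := ltnW n_gt1.
have [z z_prim] := C_prim_root_exists n_gt0.
have size_Phi := size_Cyclotomic n.
set d := totient n in le_i size_Phi *.
pose P := pZtoQ 'Phi_n; pose Q := \poly_(i < d.+1) P`_(d - i).
have size_P : size P = d.+1 by rewrite size_pZtoQ.
have P1 : P.[1] != 0.
  rewrite -[1]/(1%:~R) horner_map intr_eq0.
  rewrite -(intr_eq0 algC) -(horner_map (intr : {rmorphism int -> algC})).
  rewrite -[_ == 0]/(root _ _) root_Cyclotomic_algC //.
  apply/negP => /prim_order_dvd/(_ 1%N).
  by rewrite expr1 eqxx dvdn1 gtn_eqF.
have Q1 : Q.[1] = P.[1].
  by rewrite horner_rev_poly ?oner_eq0 ?size_P // invr1 expr1n mul1r.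
have Qz : root (map_poly ratr Q) z.
  have z0 : z != 0 by rewrite (prim_root_eq0 z_prim) -lt0n.
  have -> : map_poly ratr Q =
      \poly_(i < d.+1) (map_poly (ratr : rat -> algC) P)`_(d - i).
    apply/polyP=> j; rewrite coef_map /= coef_poly [RHS]coef_poly coef_map.
    by case: ifP => _; rewrite ?rmorph0 // coef_map /= coef_map.
  rewrite /root horner_rev_poly // ?size_map_poly ?size_P //.
  rewrite mulf_eq0 orbC map_ratr_intr -[_.[_] == 0]/(root _ _).
  rewrite root_Cyclotomic_algC //.
  have -> // : n.-primitive_root z^-1.
  have -> : z^-1 = z ^+ n.-1.
    by apply: (mulfI z0); rewrite divff // -exprS prednK // (prim_expr_order z_prim).
  by rewrite (prim_root_exp_coprime _ z_prim) coprimePn.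
have PQ : P %| Q by apply: (Cyclotomic_dvd n_gt0 _ Qz); exact: root_Cyclotomic.
have Q0 : Q != 0 by apply: contraNneq P1 => Q0; rewrite -Q1 Q0 horner0.
have eq_size : size P == size Q.
  by rewrite eqn_leq (dvdp_leq Q0 PQ) size_P size_poly.
have : P %= Q by rewrite -(dvdp_size_eqp PQ).
case/eqpf_eq=> c c0 PcQ.
have c1 : c = 1.
  by move: P1; rewrite -Q1 => P1; apply: (mulIf P1); rewrite mul1r {2}Q1 PcQ hornerZ.
have Qi : Q`_i = P`_(d - i) by rewrite coef_poly ltnS le_i.
have Pi j : ('Phi_n`_j)%:~R = P`_j by rewrite coef_map.
by apply: (@intr_inj rat); rewrite !Pi -Qi {1}PcQ c1 scale1r.
Qed.

(** * Descent from palindromic polynomials to the variable 2 - x - 1/x *)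

Section Reciprocal.
Variable A : comNzRingType.
Implicit Types p q : {poly A}.

(* [recip d q] is [x ^ d * q(2 - x - 1/x)], as
   [2 - x - 1/x = - (x - 1) ^ 2 / x]. *)
Definition recip d q : {poly A} :=
  \sum_(i < d.+1) ((-1) ^+ i * q`_i) *: (('X - 1) ^+ i.*2 * 'X^(d - i)).

Lemma size_recip_term d i : (i <= d)%N ->
  size (('X - 1) ^+ i.*2 * 'X^(d - i) : {poly A}) = (d + i).+1.
Proof.
move=> le_id; rewrite size_Mmonic ?monicXn ?monic_neq0 ?monic_exp //; last first.
  by rewrite monicXsubC.
rewrite -[1]/(1%:P) size_exp_XsubC size_polyXn; lia.
Qed.

Lemma monic_recip_term d i :
  ('X - 1) ^+ i.*2 * 'X^(d - i) \is @monic A.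
Proof. by rewrite monicMl ?monicXn // monic_exp // -[1]/(1%:P) monicXsubC. Qed.

Lemma size_recip d q : (size (recip d q) <= d.*2.+1)%N.
Proof.
apply: (leq_trans (size_sum _ _ _)); apply/bigmax_leqP => i _.
apply: (leq_trans (size_scale_leq _ _)).
have le_id : (i <= d)%N by rewrite -ltnS.
by rewrite size_recip_term // -addnn ltnS leq_add2l.
Qed.

(** Only the term [i = d] reaches degree [d.*2]. *)
Lemma coef_recip_max d q : (recip d q)`_(d.*2) = (-1) ^+ d * q`_d.
Proof.
rewrite coef_sum big_ord_recr /= big1 ?add0r => [|i _].
  have := monicP (monic_recip_term d d).
  rewrite lead_coefE size_recip_term // -addnn coefZ => ->; exact: mulr1.
have le_id : (i <= d)%N by rewrite ltnW.
rewrite coefZ [X in _ * X]nth_default ?mulr0 //.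
by rewrite size_recip_term // -addnn ltn_add2l.
Qed.

Lemma coef_Xsub1_exp n i : (i <= n)%N ->
  (('X - 1) ^+ n : {poly A})`_i = (-1) ^+ (n - i) * 'C(n, i)%:R.
Proof.
move=> le_in; rewrite exprBn coef_sum.
have lt_n : (n - i < n.+1)%N by rewrite ltnS leq_subr.
have termE (j : 'I_n.+1) : ((-1) ^+ j * 'X^(n - j) * 1 ^+ j *+ 'C(n, j) : {poly A})`_i =
    (-1) ^+ j * (i == n - j)%N%:R *+ 'C(n, j).
  have -> : (-1) ^+ j = ((-1) ^+ j)%:P :> {poly A} by rewrite rmorph_sign.
  by rewrite expr1n mulr1 coefMn coefCM coefXn.
under eq_bigr => j _ do rewrite termE.
rewrite (bigD1 (Ordinal lt_n)) //= big1 ?addr0 => [|j jn].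
  by rewrite subKn // eqxx mulr1 bin_sub // mulr_natr.
case: eqP => [eq_i|_]; last by rewrite mulr0 mul0rn.
case/eqP: jn; apply: val_inj => /=; have := ltn_ord j; lia.
Qed.

Lemma recipS d q c : (size q <= d.+1)%N ->
  recip d.+1 (q + c *: 'X^(d.+1)) =
  recip d q * 'X + ((-1) ^+ d.+1 * c) *: ('X - 1) ^+ d.+1.*2.
Proof.
move=> size_q; rewrite /recip big_ord_recr /= subnn expr0 mulr1.
rewrite coefD coefZ coefXn eqxx mulr1 (nth_default _ size_q) add0r.
congr (_ + _); rewrite mulr_suml; apply: eq_bigr => i _.
rewrite coefD coefZ coefXn ltn_eqF // mulr0 addr0 -scalerAl -mulrA -exprSr.
by rewrite subSn // -ltnS.
Qed.

(** Induction on [d]: subtracting a multiple of [('X - 1) ^+ d.+1.*2] kills the top coefficient,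
    hence by symmetry the constant one; dividing by ['X] then lowers [d]. *)
Lemma palindrome_recip d p : (size p <= d.*2.+1)%N ->
  (forall i, (i <= d.*2)%N -> p`_i = p`_(d.*2 - i)) ->
  exists2 q : {poly A}, (size q <= d.+1)%N & p = recip d q.
Proof.
elim: d p => [|d IHd] p size_p pal_p.
  exists p => //; rewrite /recip big_ord1 !expr0 !mul1r.
  by rewrite [LHS]size1_polyC // alg_polyC.
pose t := ('X - 1) ^+ d.+1.*2 : {poly A}.
have size_t : size t = d.+1.*2.+1 by rewrite /t -[1]/(1%:P) size_exp_XsubC.
pose p1 := p - p`_(d.+1.*2) *: t.
have p1_pal i : (i <= d.+1.*2)%N -> p1`_i = p1`_(d.+1.*2 - i).
  move=> le_i; rewrite !coefB !coefZ -pal_p // !coef_Xsub1_exp ?leq_subr //.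
  rewrite bin_sub // subKn // -signr_odd -[in RHS]signr_odd.
  by rewrite oddB // odd_double.
have p1_max : p1`_(d.+1.*2) = 0.
  rewrite coefB coefZ coef_Xsub1_exp // subnn binn !mulr1 subrr //.
have p1_0 : p1`_0 = 0 by rewrite p1_pal // subn0.
have size_p1 : (size p1 <= d.+1.*2)%N.
  apply/leq_sizeP => j; rewrite leq_eqVlt => /predU1P[<- // | lt_j].
  have pj0 : p`_j = 0 by rewrite nth_default // (leq_trans size_p).
  have tj0 : t`_j = 0 by rewrite nth_default // size_t.
  by rewrite coefB coefZ pj0 tj0 mulr0 subr0.
pose p2 := \poly_(i < d.*2.+1) p1`_i.+1.
have p2E i : p2`_i = p1`_i.+1.
  rewrite coef_poly; case: ltnP => // le_i.
  by rewrite nth_default // (leq_trans size_p1) // doubleS.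
have Dp1 : p1 = p2 * 'X.
  by apply/polyP => -[|i]; rewrite coefMX //= p2E.
have [||q size_q Dp2] := IHd p2; first exact: size_poly.
  by move=> i le_i; rewrite !p2E p1_pal ?doubleS ?subSS ?subSn // ltnS ltnW.
(* The sign cancels the factor [(-1) ^+ i] in [recip]. *)
pose c := (-1) ^+ d.+1 * p`_(d.+1.*2).
exists (q + c *: 'X^(d.+1)).
  rewrite (leq_trans (size_polyD _ _)) // geq_max (leq_trans size_q) //.
  by rewrite (leq_trans (size_scale_leq _ _)) // size_polyXn.
by rewrite recipS // -Dp2 -Dp1 /c mulrA -expr2 sqrr_sign mul1r subrK.
Qed.

End Reciprocal.

Lemma map_recip (A B : comNzRingType) (f : {rmorphism A -> B}) d q :
  map_poly f (recip d q) = recip d (map_poly f q).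
Proof.
rewrite rmorph_sum; apply: eq_bigr => i _ /=.
by rewrite map_polyZ rmorphM rmorph_sign coef_map rmorphM rmorphXn rmorphB /=
           map_polyX map_polyXn rmorph1.
Qed.

Lemma horner_recip (F : fieldType) d (q : {poly F}) x : x != 0 ->
  (size q <= d.+1)%N -> (recip d q).[x] = x ^+ d * q.[2 - x - x^-1].
Proof.
move=> x0 size_q; rewrite (horner_coef_wide _ size_q) horner_sum mulr_sumr.
apply: eq_bigr => i _; have le_i : (i <= d)%N by rewrite -ltnS.
rewrite !hornerE -muln2 mulnC exprM.
have -> : x ^+ d = x ^+ (d - i) * x ^+ i by rewrite -exprD subnK.
have -> : 2 - x - x^-1 = - ((x - 1) ^+ 2 / x) by field.
set y := (x - 1) ^+ 2.
have -> : (- (y / x)) ^+ i = (-1) ^+ i * y ^+ i / x ^+ i.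
  by rewrite [LHS]exprNn exprMn exprVn mulrA.
have xi0 : x ^+ i != 0 by rewrite expf_neq0.
move: (_ ^+ i) (y ^+ i) (x ^+ i) (x ^+ (d - i)) xi0 => a b c e c0.
change (a * q`_i * b * e = e * c * q`_i * (a * b / c)).
by field.
Qed.

(** * Values at sixth roots of unity *)

Lemma horner_Cyclotomic_inv m (x : algC) : (1 < m)%N -> x != 0 ->
  x ^+ totient m * (pZtoC 'Phi_m).[x^-1] = (pZtoC 'Phi_m).[x].
Proof.
move=> m_gt1 x0; have size_Phi : size (pZtoC 'Phi_m) = (totient m).+1.
  by rewrite size_map_inj_poly ?size_Cyclotomic //; apply: intr_inj.
rewrite -horner_rev_poly ?size_Phi //; congr (_.[_]); apply/polyP => i.
rewrite coef_poly; case: ltnP => [|le_i]; last by rewrite nth_default ?size_Phi.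
by rewrite ltnS => le_i; rewrite !coef_map /= -Cyclotomic_palindrome.
Qed.

(** An odd [totient m] would, by palindromy at -1, force ['Phi_m] to vanish there, but -1 is not
    primitive of order [m > 2]. *)
Lemma even_totient m : (2 < m)%N -> ~~ odd (totient m).
Proof.
move=> m_gt2; have m_gt1 := ltnW m_gt2.
have N1_neq0 : (-1 : algC) != 0 by rewrite oppr_eq0 oner_eq0.
have Phi_neq0 : (pZtoC 'Phi_m).[-1] != 0.
  rewrite -[_ == 0]/(root _ _) root_Cyclotomic_algC ?(ltnW m_gt1) //.
  apply/negP => /prim_order_dvd/(_ 2); rewrite sqrrN expr1n eqxx.
  by move/(dvdn_leq (isT : 0 < 2)%N); rewrite leqNgt m_gt2.
have := horner_Cyclotomic_inv m_gt1 N1_neq0.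
rewrite invrN1 -signr_odd; case: odd => //; rewrite expr1 mulN1r => /eqP.
by rewrite eq_sym -subr_eq0 opprK -mulr2n mulrn_eq0 (negPf Phi_neq0).
Qed.

(** The quotient [g_m] of the overview; the halving is exact for [m > 2] by [even_totient]. *)
Definition sym_Phi m (x : algC) : algC :=
  (pZtoC 'Phi_m).[x] / x ^+ (totient m)./2.

Lemma sym_PhiV m x : (2 < m)%N -> x != 0 -> sym_Phi m x^-1 = sym_Phi m x.
Proof.
move=> m_gt2 x0; rewrite /sym_Phi -(horner_Cyclotomic_inv _ x0) ?(ltnW m_gt2) //.
have := even_totient m_gt2; move: (totient m) => d d_even.
rewrite -{2}(odd_double_half d) (negPf d_even) add0n -addnn exprD exprVn invrK.
by field; rewrite expf_neq0.
Qed.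

Lemma sym_Phi_eq0 m x : (0 < m)%N -> x != 0 ->
  (sym_Phi m x == 0) = m.-primitive_root x.
Proof.
move=> m_gt0 x0; rewrite mulf_eq0 invr_eq0 expf_eq0 (negPf x0) andbF orbF.
by rewrite -[_ == 0]/(root _ _) root_Cyclotomic_algC.
Qed.

Lemma sym_Phi_dvd p m x : prime p -> (2 < m)%N -> (p %| m)%N ->
  sym_Phi (p * m) x = sym_Phi m (x ^+ p).
Proof.
move=> p_pr m_gt2 p_m; have m_gt0 : (0 < m)%N by rewrite (ltn_trans _ m_gt2).
rewrite /sym_Phi -(Cyclotomic_comp_dvd p_pr) // map_comp_poly map_polyXn.
rewrite horner_comp hornerXn totient_pmul // p_m -exprM; congr (_ / _ ^+ _).
by rewrite -{1}(even_halfK (even_totient m_gt2)) -doubleMr doubleK.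
Qed.

Lemma sym_Phi_ndvd p m x : prime p -> (2 < m)%N -> ~~ (p %| m)%N -> x != 0 ->
  sym_Phi (p * m) x * sym_Phi m x = sym_Phi m (x ^+ p).
Proof.
move=> p_pr m_gt2 p_m x0; have m_gt0 : (0 < m)%N by rewrite (ltn_trans _ m_gt2).
have /(congr1 (fun q => (pZtoC q).[x])) := Cyclotomic_comp_ndvd p_pr m_gt0 p_m.
rewrite map_comp_poly map_polyXn horner_comp hornerXn rmorphM hornerM /sym_Phi.
move=> ->; rewrite mulf_div -exprD -exprM; congr (_ / _ ^+ _).
rewrite totient_pmul // (negPf p_m) -{1}(even_halfK (even_totient m_gt2)).
by rewrite -doubleMr doubleK -mulSnr prednK ?prime_gt0.
Qed.

(** The primes of [n] are stripped off one at a time; each divides the remaining index, so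
    [sym_Phi_dvd] applies throughout. *)
Lemma sym_Phi_mul n m x : (0 < n)%N -> (2 < m)%N ->
  (forall p, prime p -> (p %| n)%N -> (p %| m)%N) ->
  sym_Phi (n * m) x = sym_Phi m (x ^+ n).
Proof.
move=> + m_gt2; elim/ltn_ind: n x => n IHn x n_gt0 n_m.
case: (leqP n 1) => [n_le1 | n_gt1].
  have -> : n = 1%N by lia.
  by rewrite mul1n expr1.
have p_pr := pdiv_prime n_gt1; have p_n := pdiv_dvd n.
move: (pdiv n) p_pr p_n => p p_pr /dvdnP[k Dn]; rewrite Dn.
have k_gt0 : (0 < k)%N by case: k Dn => // Dn; rewrite Dn in n_gt0.
have p_gt1 := prime_gt1 p_pr; rewrite mulnAC mulnC.
rewrite sym_Phi_dvd //; last first.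
- by rewrite dvdn_mull // n_m // Dn dvdn_mull.
- by nia.
rewrite IHn //; last 2 first.
- by nia.
- by move=> q q_pr q_k; rewrite n_m // Dn dvdn_mulr.
by rewrite mulnC exprM.
Qed.

Lemma coprime6 p : coprime p 6 = (p %% 6 == 1)%N || (p %% 6 == 5)%N.
Proof.
rewrite -coprime_modl; have := ltn_pmod p (isT : 0 < 6)%N.
by move: (p %% 6)%N; do 6?[case=> //].
Qed.

Lemma expr_coprime6 (x : algC) p : x ^+ 6 = 1 -> coprime p 6 ->
  x ^+ p = x \/ x ^+ p = x^-1.
Proof.
move=> x6; rewrite coprime6 (divn_eq p 6) modnMDl modn_mod.
rewrite exprD mulnC exprM x6 expr1n mul1r => /orP[]/eqP->; [by left | right].
have x0 : x != 0 by apply: contra_eq_neq x6 => ->; rewrite expr0n eq_sym oner_eq0.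
by apply: (mulfI x0); rewrite divff // -exprS.
Qed.

Lemma sym_Phi_coprime6 m x p : (2 < m)%N -> x ^+ 6 = 1 -> coprime p 6 ->
  sym_Phi m (x ^+ p) = sym_Phi m x.
Proof.
move=> m_gt2 x6 /(expr_coprime6 x6)[] -> //; rewrite sym_PhiV //.
by apply: contra_eq_neq x6 => ->; rewrite expr0n eq_sym oner_eq0.
Qed.

(** All but one factor [p] move into the argument, which becomes [x ^+ (p ^ k)], that is [x] or its
    inverse. *)
Lemma sym_Phi_pfactor p k m x : prime p -> coprime p 6 -> (2 < m)%N ->
  x ^+ 6 = 1 -> sym_Phi (p ^ k.+1 * m) x = sym_Phi (p * m) x.
Proof.
move=> p_pr p6 m_gt2 x6; have p_gt0 := prime_gt0 p_pr.
have pm_gt2 : (2 < p * m)%N by nia.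
rewrite expnSr -mulnA sym_Phi_mul ?expn_gt0 ?p_gt0 //.
  by rewrite sym_Phi_coprime6 ?coprimeXl.
move=> q q_pr; rewrite Euclid_dvdX // => /andP[q_p _].
by rewrite dvdn_mulr.
Qed.

(** Once a single factor [p] is left, multiplying by [sym_Phi m x] gives [sym_Phi m (x ^+ p)], which
    is [sym_Phi m x] again; this is nonzero and cancels. *)
Lemma sym_Phi_eq1 p k m x : prime p -> coprime p 6 -> (2 < m)%N ->
  ~~ (p %| m)%N -> x ^+ 6 = 1 -> ~~ m.-primitive_root x ->
  sym_Phi (p ^ k.+1 * m) x = 1.
Proof.
move=> p_pr p6 m_gt2 p_m x6 x_nprim; rewrite sym_Phi_pfactor //.
have x0 : x != 0 by apply: contra_eq_neq x6 => ->; rewrite expr0n eq_sym oner_eq0.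
have Phi0 : sym_Phi m x != 0 by rewrite sym_Phi_eq0 // (ltn_trans _ m_gt2).
by apply: (mulIf Phi0); rewrite mul1r sym_Phi_ndvd // sym_Phi_coprime6.
Qed.

Lemma sym_Phi6 x : x != 0 -> sym_Phi 6 x = x + x^-1 - 1.
Proof.
move=> x0; have -> : sym_Phi 6 x = (x ^+ 2 - x + 1) / x.
  rewrite /sym_Phi Cyclotomic6 rmorphD rmorphB /= map_polyXn map_polyX rmorph1.
  by rewrite !hornerE.
by field.
Qed.

Section SixthRoot.
Variable w : algC.
Hypothesis w_prim : 6.-primitive_root w.

Let w6 : w ^+ 6 = 1. Proof. exact: prim_expr_order. Qed.

Let w0 : w != 0. Proof. by rewrite (prim_root_eq0 w_prim). Qed.

Lemma prim6_sqr : w ^+ 2 = w - 1.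
Proof.
have := root_Cyclotomic w_prim.
rewrite Cyclotomic6 rmorphD rmorphB /= map_polyXn map_polyX rmorph1.
by rewrite /root !hornerE addr_eq0 subr_eq => /eqP ->; rewrite addrC.
Qed.

Lemma prim6_cube : w ^+ 3 = -1.
Proof. by rewrite exprS prim6_sqr mulrBr -expr2 prim6_sqr mulr1; ring. Qed.

(* [w] is a common root of [Phi_6(x)] and [Phi_6(x ^ p)], so the value at [w]
   of their quotient [Phi_(6p)] is read off the derivatives. *)
Lemma sym_Phi_prime6 p : prime p -> coprime p 6 ->
  sym_Phi (p * 6) w = (if (p %% 3 == 1)%N then p%:R else - p%:R).
Proof.
move=> p_pr p6; have p_gt0 := prime_gt0 p_pr.
have p_n6 : ~~ (p %| 6)%N by rewrite -prime_coprime.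
have /(congr1 (fun q => (pZtoC q)^`().[w])) :=
  Cyclotomic_comp_ndvd p_pr (isT : 0 < 6)%N p_n6.
rewrite rmorphM derivM !hornerE.
have /eqP -> : root (pZtoC 'Phi_6) w by apply: root_Cyclotomic.
rewrite mulr0 add0r map_comp_poly map_polyXn deriv_comp !hornerE horner_comp.
have dPhi6 (x : algC) : (pZtoC 'Phi_6)^`().[x] = 2 * x - 1.
  rewrite Cyclotomic6 rmorphD rmorphB /= map_polyXn map_polyX rmorph1.
  by rewrite !poly.derivE !hornerE; ring.
rewrite !dPhi6 derivXn hornerMn !hornerE => eqPhi.
(* [w] is a simple root of ['Phi_6]: the derivative there squares to -3. *)
have d0 : 2 * w - 1 != 0.
  have d2 : (2 * w - 1) ^+ 2 = - 3 :> algC.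
    have -> : (2 * w - 1) ^+ 2 = 4 * (w ^+ 2 - w) + 1 by ring.
    by rewrite prim6_sqr; ring.
  by apply: contra_eq_neq d2 => ->; rewrite expr0n eq_sym oppr_eq0 pnatr_eq0.
have totp : (totient (p * 6))./2 = p.-1.
  by rewrite totient_pmul // (negPf p_n6) -[totient 6]/(2%N) muln2 doubleK.
rewrite /sym_Phi totp.
have wq q k : w ^+ (q * 6 + k) = w ^+ k.
  by rewrite exprD mulnC exprM w6 expr1n mul1r.
move: p6 eqPhi; rewrite coprime6 {1 2}(divn_eq p 6) modnMDl modn_mod => /orP[]/eqP r.
  have Dp : p = (p %/ 6 * 6 + 1)%N by rewrite {1}(divn_eq p 6) r.
  have -> : (p %% 3 = 1)%N by rewrite Dp; lia.
  have wp : w ^+ p = w by rewrite Dp wq.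
  have wp1 : w ^+ p.-1 = 1 by rewrite Dp addn1 -[X in w ^+ X]addn0 wq.
  rewrite wp wp1 divr1 [RHS]/= => /esym eqPhi.
  by apply: (mulIf d0); rewrite eqPhi mulrC.
have Dp : p = (p %/ 6 * 6 + 5)%N by rewrite {1}(divn_eq p 6) r.
have -> : (p %% 3 = 2)%N by rewrite Dp; lia.
have -> : w ^+ p = w ^+ 5 by rewrite Dp wq.
have wp1 : w ^+ p.-1 = w ^+ 4 by rewrite Dp addnS wq.
(* Hence [2 * w ^+ 5 - 1] is the opposite of [2 * w - 1], the source of the minus sign. *)
have -> : w ^+ 5 = 1 - w.
  by rewrite (exprD _ 3 2) prim6_cube prim6_sqr mulN1r opprB.
rewrite wp1 [RHS]/= => /esym eqPhi; apply: (mulIf d0).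
rewrite mulrAC eqPhi -mulr_natr; field.
by rewrite w0.
Qed.


End SixthRoot.

(** * Values for all n, sorted by prime factors *)

Lemma prime_dvd6 p : prime p -> (p %| 6)%N -> p = 2%N \/ p = 3%N.
Proof.
move=> p_pr; rewrite (Euclid_dvdM 2 3 p_pr) !dvdn_prime2 //.
by case/orP=> /eqP; [left | right].
Qed.

Lemma two_three_pnat n : (0 < n)%N ->
  (forall p, prime p -> (p %| n)%N -> ~~ coprime p 6) ->
  [\/ exists k, n = (2 ^ k)%N, exists k, n = (3 ^ k)%N | (6 %| n)%N].
Proof.
move=> n_gt0 n_p.
have p23 p : prime p -> (p %| n)%N -> p = 2%N \/ p = 3%N.
  move=> p_pr /(n_p p p_pr); rewrite prime_coprime // negbK.
  exact: prime_dvd6.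
case n2 : (2 %| n)%N; last first.
  apply: Or32; have /p_natP[k ->] : (3.-nat n)%N; last by exists k.
  apply/pnatP => // p p_pr p_n.
  by case: (p23 p p_pr p_n) => Dp; rewrite Dp // in p_n *; rewrite n2 in p_n.
case n3 : (3 %| n)%N; last first.
  apply: Or31; have /p_natP[k ->] : (2.-nat n)%N; last by exists k.
  apply/pnatP => // p p_pr p_n.
  by case: (p23 p p_pr p_n) => Dp; rewrite Dp // in p_n *; rewrite n3 in p_n.
by apply: Or33; rewrite (@Gauss_dvd 2 3) // n2.
Qed.

Lemma primitive6_1 m : (1 < m)%N -> ~~ m.-primitive_root (1 : algC).
Proof.
move=> m_gt1; apply/negP => /prim_order_dvd/(_ 1%N).
by rewrite expr1 eqxx dvdn1 gtn_eqF.
Qed.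

(** Either the full power of a prime above 3 is split off, ready for [sym_Phi_eq1], or all primes of
    [n] divide 6, as [sym_Phi_mul] requires. *)
Lemma sym_Phi_cases n : (0 < n)%N ->
  (exists p k n', [/\ prime p, coprime p 6, ~~ (p %| n' * 6)%N, (0 < n')%N &
     n = (p ^ k.+1 * n')%N]) \/
  (forall p, prime p -> (p %| n)%N -> ~~ coprime p 6).
Proof.
move=> n_gt0.
case: (altP (@allP _ (fun p => ~~ coprime p 6) (primes n))) => [n_p | ].
  by right=> p p_pr p_n; apply: n_p; rewrite mem_primes p_pr n_gt0.
rewrite -has_predC => /hasP[p]; rewrite mem_primes /= negbK.
case/and3P=> p_pr _ p_n p6; left.
have [n' cn' Dn] := pfactor_coprime p_pr n_gt0.
have lp : (0 < logn p n)%N by rewrite logn_gt0 mem_primes p_pr n_gt0.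
exists p, (logn p n).-1, n'; split => //.
- by rewrite -prime_coprime // coprimeMr cn'.
- by case: n' Dn {cn'} => // Dn; rewrite Dn in n_gt0.
- by rewrite prednK // mulnC.
Qed.

(** This will be the constant coefficient, which fixes the sign of [phi]. A prime above 3 cancels,
    as 1 is not primitive of order above 1; otherwise the value is [sym_Phi 6 1]. *)
Lemma sym_Phi_1 n : (0 < n)%N -> sym_Phi (n * 6) 1 = 1.
Proof.
move=> n_gt0; case: (sym_Phi_cases n_gt0)
  => [[p [k [n' [p_pr p6 p_n' n'_gt0 ->]]]] | n_p].
  rewrite -mulnA sym_Phi_eq1 ?expr1n ?primitive6_1 //; lia.
rewrite sym_Phi_mul // ?expr1n ?sym_Phi6 ?oner_eq0 ?invr1 ?addrK // => p p_pr p_n.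
by have := n_p p p_pr p_n; rewrite prime_coprime // negbK.
Qed.

(** For [p > 3] this reduces to [sym_Phi_prime6]. For 2 and 3 it is [sym_Phi 6] at
    [w ^+ (p ^ k.+1)], a primitive cube root of unity or -1, with value -2 or -3. *)
Lemma sym_Phi_prime_power w p k : 6.-primitive_root w -> prime p ->
  sym_Phi (p ^ k.+1 * 6) w = (if (p %% 3 == 1)%N then p%:R else - p%:R).
Proof.
move=> w_prim p_pr; have w6 := prim_expr_order w_prim.
have w0 : w != 0 by rewrite (prim_root_eq0 w_prim).
case p6 : (coprime p 6).
  by rewrite sym_Phi_pfactor // sym_Phi_prime6.
have p_6 : (p %| 6)%N by move: p6; rewrite prime_coprime // => /negbFE.
rewrite sym_Phi_mul ?expn_gt0 ?prime_gt0 //; last first.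
  by move=> q q_pr; rewrite Euclid_dvdX // dvdn_prime2 // => /andP[/eqP->].
rewrite sym_Phi6 ?expf_neq0 //.
case: (prime_dvd6 p_pr p_6) => -> {p p_pr p6 p_6}; last first.
  suff -> : w ^+ (3 ^ k.+1) = -1 by rewrite invrN1 /=; ring.
  by rewrite expnS exprM (prim6_cube w_prim) -signr_odd oddX orbT.
have y1 : w ^+ (2 ^ k.+1) + (w ^+ (2 ^ k.+1))^-1 = -1.
  have y0 : w ^+ (2 ^ k.+1) != 0 by rewrite expf_neq0.
  suff : w ^+ (2 ^ k.+1) ^+ 2 + w ^+ (2 ^ k.+1) + 1 = 0.
    move=> y2; apply: (mulfI y0); apply/eqP; rewrite -subr_eq0 -y2; apply/eqP.
    by field.
  elim: k {y0} => [|k IHk].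
    have -> : w ^+ (2 ^ 1) = w - 1 by rewrite (prim6_sqr w_prim).
    have -> : (w - 1) ^+ 2 + (w - 1) + 1 = w ^+ 2 - w + 1 by ring.
    by rewrite (prim6_sqr w_prim); ring.
  rewrite expnSr exprM; set y := w ^+ _ in IHk *.
  (* The factorisation shows that squaring preserves [y ^+ 2 + y + 1 = 0]. *)
  have -> : y ^+ 2 ^+ 2 + y ^+ 2 + 1 = (y ^+ 2 + y + 1) * (y ^+ 2 - y + 1) by ring.
  by rewrite IHk mul0r.
by rewrite y1 /=; ring.
Qed.

(** If a prime above 3 divides [n], the cofactor [n'] exceeds 1, so [w] is not primitive of order
    [n' * 6]. Otherwise 6 divides [n], and [w ^+ n = 1]. *)
Lemma sym_Phi_not_prime_power w n : 6.-primitive_root w -> (0 < n)%N ->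
  (forall p k, prime p -> n <> (p ^ k)%N) -> sym_Phi (n * 6) w = 1.
Proof.
move=> w_prim n_gt0 npp; have w6 := prim_expr_order w_prim.
have w0 : w != 0 by rewrite (prim_root_eq0 w_prim).
case: (sym_Phi_cases n_gt0) => [[p [k [n' [p_pr p6 p_n' n'_gt0 Dn]]]] | n_p].
  rewrite Dn -mulnA sym_Phi_eq1 //; first by lia.
  apply/negP => w_prim'.
  have : (n' * 6 %| 6)%N by rewrite (prim_order_dvd w_prim') w6.
  move/(dvdn_leq (isT : 0 < 6)%N) => le6; apply: (npp p k.+1 p_pr).
  have n'1 : n' = 1%N by lia.
  by rewrite Dn n'1 muln1.
rewrite sym_Phi_mul // => [|p p_pr p_n]; last first.
  by have := n_p p p_pr p_n; rewrite prime_coprime // negbK.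
case: (two_three_pnat n_gt0 n_p) => [[k Dn]|[k Dn]|/dvdnP[k ->]].
- by case: (npp 2%N k).
- by case: (npp 3%N k).
by rewrite mulnC exprM w6 expr1n sym_Phi6 ?oner_eq0 // invr1 addrK.
Qed.

(** * The minimal polynomial of [4 * sin (pi / N) ^+ 2] *)

(** As ['Phi_N] is monic, its top coefficient determines that of [q] through [coef_recip_max], and
    with it the exact degree. *)
Lemma Cyclotomic_recip N : (2 < N)%N ->
  exists q : {poly int}, [/\ size q = (totient N)./2.+1,
    lead_coef q = (-1) ^+ (totient N)./2 & 'Phi_N = recip (totient N)./2 q].
Proof.
move=> N_gt2; have := Cyclotomic_palindrome (ltnW N_gt2).
have := monicP (Cyclotomic_monic N); rewrite lead_coefE.
rewrite size_Cyclotomic -{1 2 3}(even_halfK (even_totient N_gt2)).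
set d := (totient N)./2 => lead_Phi pal.
have size_Phi : (size 'Phi_N <= d.*2.+1)%N.
  by rewrite size_Cyclotomic even_halfK ?even_totient.
have [|q size_q Dq] := palindrome_recip size_Phi; first by move=> i; apply: pal.
exists q; have qd : q`_d = (-1) ^+ d.
  have := coef_recip_max d q; rewrite -Dq lead_Phi => /(congr1 ( *%R ((-1) ^+ d))).
  by rewrite mulrA -expr2 sqrr_sign mul1r mulr1.
have eq_size : size q = d.+1.
  apply/eqP; rewrite eqn_leq size_q ltnNge; apply/negP => size_q_le.
  have := signr_eq0 int d.
  by rewrite -qd nth_default ?eqxx.
by split=> //; rewrite lead_coefE eq_size.
Qed.

Lemma sym_Phi_recip N (q : {poly int}) x : (size q <= (totient N)./2.+1)%N ->
  'Phi_N = recip (totient N)./2 q -> x != 0 ->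
  sym_Phi N x = (pZtoC q).[2 - x - x^-1].
Proof.
move=> size_q Dq x0; rewrite /sym_Phi {1}Dq map_recip horner_recip //.
  by rewrite mulrAC divff ?mul1r // expf_neq0.
by rewrite (leq_trans _ size_q) // size_poly.
Qed.

Section MinimalPolynomial.
Variable R : realType.
Local Notation C := (complex R).
Implicit Types t : R.

(** The number [exp(it)], taken over [R] and not in [algC] because [sin] and [pi] live in [R]. *)
Definition cis t : C := Complex (cos t) (sin t).

Lemma cisD s t : cis (s + t) = cis s * cis t.
Proof. by rewrite /cis cosD sinD [sin s * _ + _]addrC. Qed.

Lemma cisX t k : cis t ^+ k = cis (t *+ k).
Proof.
elim: k => [|k IHk]; first by rewrite expr0 mulr0n /cis cos0 sin0.
by rewrite exprS IHk mulrS cisD.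
Qed.

(** A smaller order [m] would give [cos (2 * pi * m / N) = 1], hence [sin (pi * m / N) = 0],
    although this angle lies strictly between 0 and [pi]. *)
Lemma cis_prim N : (0 < N)%N -> N.-primitive_root (cis (pi / N%:R *+ 2)).
Proof.
move=> N_gt0; have N_neq0 : (N%:R : R) != 0 by rewrite pnatr_eq0 -lt0n.
have cisN : cis (pi / N%:R *+ 2) ^+ N = 1.
  by rewrite cisX mulrnAC -[_ / _ *+ N]mulr_natr divfK // /cis cos2pi sin2pi.
have [m m_prim m_N] := prim_order_exists N_gt0 cisN.
suff Nm : N = m by rewrite {1}Nm.
apply/eqP; rewrite eqn_leq (dvdn_leq N_gt0 m_N) andbT leqNgt; apply/negP => m_lt.
have m_gt0 := prim_order_gt0 m_prim.
have := prim_expr_order m_prim; rewrite cisX mulrnAC => -[+ _].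
rewrite cos_mulr2n cos2sin2 => eq1.
have : 0 < sin (pi / N%:R *+ m : R).
  rewrite sin_gt0_pi //; have pi_gt0 := pi_gt0 R.
  rewrite -mulr_natr mulr_gt0 ?divr_gt0 ?ltr0n //=.
  by rewrite mulrAC ltr_pdivrMr ?ltr0n // ltr_pM2l // ltr_nat.
suff -> : sin (pi / N%:R *+ m : R) = 0 by rewrite ltxx.
apply/eqP; rewrite -sqrf_eq0; apply/eqP.
move: (_ ^+ 2) eq1 => s; lra.
Qed.

Lemma cis_neq0 t : cis t != 0.
Proof.
apply/eqP => -[c0 s0]; have := cos2Dsin2 t.
by rewrite c0 s0 expr0n addr0 => /eqP; rewrite eq_sym oner_eq0.
Qed.

Lemma cis_recip t :
  2 - cis (t *+ 2) - (cis (t *+ 2))^-1 = real_complex R (4 * sin t ^+ 2).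
Proof.
have -> : (cis (t *+ 2))^-1 = cis (- (t *+ 2)).
  apply: (mulfI (cis_neq0 (t *+ 2))); rewrite divff ?cis_neq0 //.
  have := cisD (t *+ 2) (- (t *+ 2)); rewrite subrr.
  by rewrite /cis cos0 sin0 => <-.
rewrite /cis cosN sinN cos_mulr2n cos2sin2.
apply/eqP; rewrite eq_complex /=; apply/andP; split; apply/eqP; ring.
Qed.

Lemma root_recip_cis (F : numFieldType) (f : {rmorphism F -> R}) d t (q : {poly F}) :
  (size q <= d.+1)%N ->
  root (map_poly (real_complex R \o f) (recip d q)) (cis (t *+ 2)) =
  root (map_poly f q) (4 * sin t ^+ 2).
Proof.
move=> size_q; rewrite map_recip /root horner_recip ?cis_neq0 //; last first.
  by rewrite (leq_trans _ size_q) // size_poly.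
rewrite cis_recip mulf_eq0 expf_eq0 (negPf (cis_neq0 _)) andbF /=.
by rewrite map_poly_comp horner_map fmorph_eq0.
Qed.

(** For minimality, [recip] of [r] vanishes at a primitive [N]-th root, so ['Phi_N] divides it; its
    degree is at most twice that of [r], which is therefore at least [totient N / 2]. *)
Lemma min_poly_sin N (q : {poly int}) : (2 < N)%N ->
  size q = (totient N)./2.+1 -> 'Phi_N = recip (totient N)./2 q ->
  root (map_poly ratr (pZtoQ q)) (4 * sin (pi / N%:R : R) ^+ 2) /\
  forall r : {poly rat}, r != 0 ->
    root (map_poly ratr r) (4 * sin (pi / N%:R : R) ^+ 2) ->
    (size q <= size r)%N.
Proof.
move=> N_gt2 size_q Dq; have N_gt0 : (0 < N)%N by rewrite (ltn_trans _ N_gt2).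
have z_prim := cis_prim N_gt0; set z := cis _ in z_prim.
have Phi_z : root (map_poly intr 'Phi_N) z by apply: root_Cyclotomic.
have ratrC p : map_poly (real_complex R \o ratr) p = map_poly ratr p.
  by apply: eq_map_poly => a; rewrite /= fmorph_rat.
split.
  rewrite -(@root_recip_cis _ _ (totient N)./2) ?size_pZtoQ ?size_q //.
  by rewrite ratrC -map_recip -Dq map_ratr_intr.
move=> r r0; have size_r : (0 < size r)%N by rewrite size_poly_gt0.
rewrite -(@root_recip_cis _ _ (size r).-1) ?prednK // ratrC => rz.
have := Cyclotomic_dvd N_gt0 Phi_z rz.
have r'0 : recip (size r).-1 r != 0.
  apply: contraNneq r0 => r'0; rewrite -lead_coef_eq0 lead_coefE.
  have := coef_recip_max (size r).-1 r; rewrite r'0 coef0 => /esym/eqP.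
  by rewrite mulf_eq0 signr_eq0.
move/(dvdp_leq r'0)/leq_trans/(_ (size_recip _ _)).
rewrite size_pZtoQ size_Cyclotomic ltnS size_q.
by rewrite -(even_halfK (even_totient N_gt2)) leq_double; lia.
Qed.

End MinimalPolynomial.

(** * Identification of [phi] and its value at 1 *)

Lemma is_min_poly_unique (R : realType) (x : R) (p q : {poly rat}) :
  is_min_poly x p -> is_min_poly x q -> p = q.
Proof.
move=> [p_monic px p_min] [q_monic qx q_min]; apply/eqP; rewrite -subr_eq0.
apply/negPn/negP => pq0.
have eq_size : size p = size q.
  by apply/eqP; rewrite eqn_leq p_min ?q_min ?monic_neq0.
have : (size p <= size (p - q)%R)%N.
  by apply: p_min pq0 _; rewrite /root rmorphB !hornerE (eqP px) (eqP qx) subrr.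
(* Both are monic of the same size, so the leading terms cancel. *)
apply/negP; rewrite -ltnNge.
have size_p : (0 < size p)%N by rewrite size_poly_gt0 monic_neq0.
rewrite -(prednK size_p) ltnS; apply/leq_sizeP => j.
rewrite leq_eqVlt coefB => /predU1P[<- | lt_j].
  have := monicP p_monic; have := monicP q_monic.
  by rewrite !lead_coefE eq_size => -> ->; rewrite subrr.
by rewrite prednK // in lt_j; rewrite !nth_default ?subrr -?eq_size.
Qed.

(** The parity of [totient N / 2] decides whether [q] or [- q] is monic. Every candidate for [phi]
    is one of the two, and a positive constant coefficient leaves only [q]. *)
Lemma phi_recip (R : realType) N (q : {poly int}) : (2 < N)%N ->
  size q = (totient N)./2.+1 -> lead_coef q = (-1) ^+ (totient N)./2 ->
  'Phi_N = recip (totient N)./2 q -> 0 < q`_0 -> phi R N = q.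
Proof.
move=> N_gt2 size_q lead_q Dq q0.
have [q_root q_min] := @min_poly_sin R N q N_gt2 size_q Dq.
have q_min_poly :
    is_min_poly (4 * sin (pi / N%:R : R) ^+ 2) (pZtoQ q) \/
    is_min_poly (4 * sin (pi / N%:R : R) ^+ 2) (- pZtoQ q).
  have lead_qQ : lead_coef (pZtoQ q) = (-1) ^+ (totient N)./2.
    rewrite lead_coef_map_inj ?lead_q ?rmorph_sign //; exact: intr_inj.
  move: lead_qQ; rewrite -signr_odd; case: odd => lead_qQ; [right | left].
    split; first by rewrite monicE lead_coefN lead_qQ opprK.
      by rewrite rmorphN rootN.
    by move=> r; rewrite size_polyN size_pZtoQ; apply: q_min.
  split=> //; first by rewrite monicE lead_qQ.
  by move=> r; rewrite size_pZtoQ; apply: q_min.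
apply: xget_unique; first by split.
move=> p [p_min_poly p0].
have [// | Dp] : p = q \/ p = - q.
  have injQ := map_inj_poly (intr_inj : injective (intr : int -> rat)) (mulr0z 1).
  case: p_min_poly q_min_poly => [pm | pm] [qm | qm];
    have Dpq := is_min_poly_unique pm qm.
  - by left; apply: injQ.
  - by right; apply: injQ; rewrite rmorphN Dpq.
  - by right; apply: injQ; rewrite rmorphN /= -Dpq opprK.
  - by left; apply: injQ; apply: oppr_inj.
by move: p0; rewrite Dp coefN oppr_gt0 ltNge ltW.
Qed.

(** In [sym_Phi N x = q(2 - x - 1/x)], the point [x = 1] gives [q(0) = 1], so [q] is [phi], and
    [x = w] gives [q(1)], because [w + 1/w = 1]. *)
Lemma phi_horner1 (R : realType) n w : (0 < n)%N -> 6.-primitive_root w ->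
  ((phi R (6 * n)).[1])%:~R = sym_Phi (n * 6) w.
Proof.
move=> n_gt0 w_prim; have N_gt2 : (2 < 6 * n)%N by lia.
have [q [size_q lead_q Dq]] := Cyclotomic_recip N_gt2.
have sym_q x := @sym_Phi_recip (6 * n) q x (eq_leq size_q) Dq.
have q0 : q`_0 = 1.
  have := sym_Phi_1 n_gt0; rewrite mulnC sym_q ?oner_eq0 //.
  have -> : 2 - 1 - 1^-1 = 0 :> algC by rewrite invr1; ring.
  by rewrite horner_coef0 coef_map => q1; apply: (@intr_inj algC).
rewrite (phi_recip R N_gt2 size_q lead_q Dq) ?q0 // mulnC.
have w0 : w != 0 by rewrite (prim_root_eq0 w_prim).
rewrite [RHS]sym_q //.
have -> : 2 - w - w^-1 = 1.
  apply: (mulfI w0); rewrite !mulrBr divff // mulr1 -expr2 (prim6_sqr w_prim); ring.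
by rewrite -[1 in RHS]/(1%:~R) horner_map.
Qed.

Lemma v_prime_power p k : prime p -> v (p ^ k.+1) = p.
Proof.
move=> p_pr; apply: xget_unique; first by split=> //; exists k.+1.
move=> q [q_pr [j j_gt0 Dq]]; apply/eqP; rewrite -dvdn_prime2 //.
have : (q %| p ^ k.+1)%N by rewrite Dq dvdn_exp.
by rewrite Euclid_dvdX // => /andP[].
Qed.

Lemma vP n : (1 < n)%N ->
  (exists p k, [/\ prime p, n = (p ^ k.+1)%N & v n = p]) \/
  (forall p k, prime p -> n <> (p ^ k)%N) /\ v n = 1%N.
Proof.
move=> n_gt1.
have [[p [p_pr [[|k] // _ Dn]]] | npp] :=
    pselect (exists p, prime p /\ exists2 k, (1 <= k)%N & n = (p ^ k)%N).
  by left; exists p, k; rewrite Dn v_prime_power.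
right; split=> [p k p_pr Dn | ].
  apply: npp; exists p; split=> //; exists k => //.
  by case: k Dn => // Dn; rewrite Dn in n_gt1.
by apply: xgetPN => p pP; apply: npp; exists p.
Qed.

Theorem theorem5 (R : realType) (n : nat) (hn : (3 <= n)%N) :
  (((v n)%:Z = 1 %[mod 3])%Z ->
     (phi R (6 * n)).[1] = (v n)%:Z) /\
  (((v n)%:Z = -1 %[mod 3])%Z \/ v n = 2%N \/ v n = 3%N ->
     (phi R (6 * n)).[1] = - (v n)%:Z).
Proof.
have [w w_prim] := C_prim_root_exists (isT : (0 < 6)%N).
have n_gt0 : (0 < n)%N by lia.
have n_gt1 : (1 < n)%N by lia.
have phi1 := phi_horner1 R n_gt0 w_prim.
case: (vP n_gt1) => [[p [k [p_pr Dn ->]]] | [npp ->]].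
  have {}phi1 : (phi R (6 * n)).[1] = if (p %% 3 == 1)%N then p%:Z else - p%:Z.
    apply: (@intr_inj algC); rewrite phi1 Dn sym_Phi_prime_power //.
    by case: ifP => _; rewrite ?rmorphN.
  (* The negative branch covers [p = 3] and every [p] congruent to -1, including 2. *)
  by rewrite phi1; case: eqP; lia.
have {}phi1 : (phi R (6 * n)).[1] = 1.
  by apply: (@intr_inj algC); rewrite phi1 sym_Phi_not_prime_power.
(* [v n = 1] meets only the first hypothesis. *)
by rewrite phi1; lia.
Qed.
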